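(* Let $1<p<\infty$, $T>0$, and let $\Omega$ be an arbitrary measurable subset of $\mathbb{R}^N$. Let $k\in W^{1,1}([0,T])$ be nonnegative and nonincreasing. Then for any $u_0\in L_p(\Omega)$ and any $u\in L_p([0,T];L_p(\Omega))$ there holds $$|u(t)|_{L_p(\Omega)}^{p-1}\,\partial_t\Big(k\ast\big(|u(\cdot)|_{L_p(\Omega)}-|u_0|_{L_p(\Omega)}\big)\Big)(t)\le\int_\Omega|u(t,x)|^{p-2}u(t,x)\,\partial_t\big(k\ast[u-u_0]\big)(t,x)\,dx$$ for a.a. $t\in(0,T)$.
   Context: $(k\ast v)(t)=\int_0^tk(t-\tau)v(\tau)\,d\tau$ is convolution in the time variable; $u_0$ is regarded as constant in time. Convention: $y|y|^{-\beta}$ is equal to $0$ for $y=0$ whenever $\beta\in(0,1)$ (relevant for $|u|^{p-2}u$ when $1<p<2$). *)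

(* Defs.v *)
From HB Require Import structures.
From mathcomp Require Import all_boot all_order all_algebra.
From mathcomp Require Import all_classical all_reals all_analysis.

Set Implicit Arguments.
Unset Strict Implicit.
Unset Printing Implicit Defensive.

Import Order.TTheory GRing.Theory Num.Theory.
Import numFieldNormedType.Exports.

Local Open Scope classical_set_scope.
Local Open Scope ring_scope.

Definition cons_tuple_pair (T : Type) (n : nat) (z : T * n.-tuple T) :
  n.+1.-tuple T := [tuple of z.1 :: z.2].

Definition uncons_tuple (T : Type) (n : nat) (x : n.+1.-tuple T) :
  T * n.-tuple T := (thead x, [tuple of behead x]).

Lemma cons_tuple_pairK (T : Type) (n : nat) :
  cancel (@cons_tuple_pair T n) (@uncons_tuple T n).
Proof. by case=> a x; congr pair; apply/val_inj. Qed.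

Lemma measurable_cons_tuple_pair d (T : measurableType d) (n : nat) :
  measurable_fun [set: T * n.-tuple T] (@cons_tuple_pair T n).
Proof. exact: measurable_cons. Qed.

Lemma measurable_uncons_tuple d (T : measurableType d) (n : nat) :
  measurable_fun [set: n.+1.-tuple T] (@uncons_tuple T n).
Proof.
by apply/measurable_fun_pair; [exact: measurable_tnth|exact: measurable_behead].
Qed.

Section lebesgue_step.
Context (R : realType) (n : nat).
Variable m : {sigma_finite_measure set (n.-tuple (measurableTypeR R)) -> \bar R}.

Definition lebesgue_step : set (n.+1.-tuple (measurableTypeR R)) -> \bar R :=
  pushforward (@lebesgue_measure R \x m)%E
    (@cons_tuple_pair (measurableTypeR R) n).

Let step0 : lebesgue_step set0 = 0%E.
Proof. by rewrite /lebesgue_step /pushforward preimage_set0 measure0. Qed.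

Let step_ge0 A : (0 <= lebesgue_step A)%E.
Proof. by rewrite /lebesgue_step /pushforward; exact: measure_ge0. Qed.

Let step_sigma_additive : semi_sigma_additive lebesgue_step.
Proof.
have mc := @measurable_cons_tuple_pair _ (measurableTypeR R) n.
move=> F mF tF mUF; rewrite /lebesgue_step /pushforward preimage_bigcup.
apply: measure_semi_sigma_additive.
- by move=> i; rewrite -[X in measurable X]setTI; exact: mc.
- apply/trivIsetP => /= i j _ _ ij; rewrite -preimage_setI.
  by move/trivIsetP : tF => /(_ _ _ _ _ ij) ->//; rewrite preimage_set0.
- by rewrite -preimage_bigcup -[X in measurable X]setTI; exact: mc.
Qed.

HB.instance Definition _ := isMeasure.Build _ _ _ lebesgue_step
  step0 step_ge0 step_sigma_additive.

Let step_sigma_finite : sigma_finite setT lebesgue_step.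
Proof.
have /sigma_finiteP[F [TF ndF Foo]] := sigma_finiteT (@lebesgue_measure R).
have /sigma_finiteP[G [TG ndG Goo]] := sigma_finiteT m.
exists (fun k => @uncons_tuple (measurableTypeR R) n @^-1` (F k `*` G k)).
  rewrite -preimage_bigcup (_ : \bigcup_k _ = setT) ?preimage_setT//.
  rewrite -subTset => -[x y] _.
  have [i _ Fix] : (\bigcup_i F i) x by rewrite -TF.
  have [j _ Gjy] : (\bigcup_i G i) y by rewrite -TG.
  exists (maxn i j) => //; split => /=.
  - by move: x Fix; exact/subsetPset/ndF/leq_maxl.
  - by move: y Gjy; exact/subsetPset/ndG/leq_maxr.
move=> k; have [mF Fk] := Foo k; have [mG Gk] := Goo k; split.
  rewrite -[X in measurable X]setTI.
  by apply: measurable_uncons_tuple => //; exact: measurableX.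
rewrite /lebesgue_step /pushforward -comp_preimage.
rewrite (_ : _ \o _ = id); last first.
  by apply/funext => z /=; rewrite cons_tuple_pairK.
by rewrite preimage_id product_measure1E// lte_mul_pinfty// ge0_fin_numE.
Qed.

HB.instance Definition _ := Measure_isSigmaFinite.Build _ _ _ lebesgue_step
  step_sigma_finite.

End lebesgue_step.

(* Lebesgue measure on the Borel sets of R^N, as the N-fold product of the
   one-dimensional Lebesgue measure *)
Fixpoint borel_lebesgue (R : realType) (N : nat) :
    {sigma_finite_measure set (N.-tuple (measurableTypeR R)) -> \bar R} :=
  match N with
  | 0 => [the {sigma_finite_measure set _ -> \bar R} of
           \d_([tuple] : 0.-tuple (measurableTypeR R))]
  | n.+1 => [the {sigma_finite_measure set _ -> \bar R} of
           lebesgue_step (borel_lebesgue R n)]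
  end.

(* R^N with the Lebesgue sigma-algebra: the Caratheodory-measurable sets of
   the outer measure induced by [borel_lebesgue] *)
Definition euclidean (R : realType) (N : nat) :=
  caratheodory_type ((borel_lebesgue R N)^*)%mu.

HB.instance Definition _ (R : realType) (N : nat) :=
  Measurable.on (euclidean R N).

Definition lebesgueN (R : realType) (N : nat) : set (euclidean R N) -> \bar R :=
  @completed_measure_extension _ _ _ (borel_lebesgue R N).

HB.instance Definition _ (R : realType) (N : nat) :=
  Measure.on (@lebesgueN R N).

Lemma lebesgueN_sigma_finite (R : realType) (N : nat) :
  sigma_finite setT (@lebesgueN R N).
Proof. exact/completed_measure_extension_sigma_finite/sigma_finiteT. Qed.

HB.instance Definition _ (R : realType) (N : nat) :=
  Measure_isSigmaFinite.Build _ _ _ (@lebesgueN R N)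
    (@lebesgueN_sigma_finite R N).

(* C^1_c(]0, T[), the test functions of Brezis' definition of W^{1,1} on an
   interval; the support lies in [`[a, b]] *)
Definition test_function (R : realType) (T : R) (phi : R -> R) : Prop :=
  [/\ forall x, derivable phi x 1,
      continuous (derive1 phi) &
      exists a b : R, [/\ 0 < a, b < T &
        forall x, x \notin `[a, b] -> phi x = 0]].

Definition W11 (R : realType) (T : R) (k : R -> R) : Prop :=
  let mu := @lebesgue_measure R in
  mu.-integrable `[0, T] (EFin \o k) /\
  exists dk : R -> R, mu.-integrable `[0, T] (EFin \o dk) /\
    forall phi : R -> R, test_function T phi ->
      \int[mu]_(t in `[0, T]) (k t * derive1 phi t) =
      - \int[mu]_(t in `[0, T]) (dk t * phi t).

Definition time_conv (R : realType) (k v : R -> R) (t : R) : R :=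
  \int[@lebesgue_measure R]_(tau in `[0, t]) (k (t - tau) * v tau).

Section Lp.
Context (R : realType) (N : nat) (Omega : set (euclidean R N)) (p : R).

Definition in_Lp (f : euclidean R N -> R) : Prop :=
  f \_ Omega \in Lfun (@lebesgueN R N) p%:E.

Definition Lp_norm (f : euclidean R N -> R) : R :=
  fine ('N[@lebesgueN R N]_p%:E[EFin \o (f \_ Omega)])%E.

(* u \in L_p([0, T]; L_p(Omega)), given by a jointly measurable
   representative (t, x) |-> u t x *)
Definition in_LpLp (T : R) (u : R -> euclidean R N -> R) : Prop :=
  measurable_fun (`[0, T]%classic `*` Omega : set (measurableTypeR R * _))
    (fun z => u z.1 z.2) /\
  (\int[@lebesgue_measure R]_(t in `[0%R, T])
     ('N[@lebesgueN R N]_p%:E[EFin \o (u t \_ Omega)]) `^ p < +oo)%E.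

End Lp.

(* Main.v *)
Require Import Defs.
From HB Require Import structures.
From mathcomp Require Import all_boot all_order all_algebra.
From mathcomp Require Import all_classical all_reals all_analysis.
From mathcomp Require Import measurable_realfun ring.
Import Order.TTheory GRing.Theory Num.Theory.
Import numFieldNormedType.Exports.

Local Open Scope classical_set_scope.
Local Open Scope ring_scope.

(* A nonnegative nonincreasing kernel is a superposition of indicators of
   intervals: there is a finite measure [nu] on [0, T] with
   [k r = nu `]r, +oo[] for a.e. [r].  By Fubini and translation invariance the
   convolution [k * w] (with [w] extended by 0 to negative times) is then a
   primitive of [t |-> \int[nu]_s (w t - w (t - s))], so this is its derivative
   at a.e. [t].  Extending [u] by the constant history [u0] to negative times,
   the claim becomes, for a fixed [t], the [nu]-integral over the delay [s] of
     |u t|^(p-1) (|u t| - |u (t - s)|)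
       <= \int |u t|^(p-2) u t (u t - u (t - s)),
   which is Hoelder's inequality.  That the derivative formula, valid for a.e.
   [t] at a.e. fixed [x], holds for a.e. [x] at a.e. fixed [t] needs the joint
   measurability of the exceptional set, for which differentiability is tested
   on rational increments. *)

(** * Almost everywhere properties and translations *)

Section almost_everywhere.
Context d (T : measurableType d) {R : realType}.
Variable m : {measure set T -> \bar R}.

Lemma ae_imply (P Q : T -> Prop) : (forall x, P x -> Q x) ->
  {ae m, forall x, P x} -> {ae m, forall x, Q x}.
Proof. by move=> PQ; apply: filterS. Qed.

Lemma ae_imply2 (P1 P2 Q : T -> Prop) : (forall x, P1 x -> P2 x -> Q x) ->
  {ae m, forall x, P1 x} -> {ae m, forall x, P2 x} -> {ae m, forall x, Q x}.
Proof. by move=> PQ; apply: filterS2. Qed.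

End almost_everywhere.

Section lebesgue_translation.
Context {R : realType}.
Local Notation mu := (@lebesgue_measure R).

Let measurable_shift (c : R) : measurable_fun setT (fun x : R => x - c).
Proof. exact: measurable_funB. Qed.

Let measurable_reflect (c : R) : measurable_fun setT (fun x : R => c - x).
Proof. exact: measurable_funB. Qed.

(** By uniqueness of Lebesgue measure only half-open intervals matter, and the preimage of []a, b]]
    is []a + c, b + c]], of the same length. *)
Lemma lebesgue_measure_shift (c : R) (A : set R) : measurable A ->
  pushforward mu ((fun x => x - c) : _ -> measurableTypeR R) A = mu A.
Proof.
move=> mA; pose sc : {mfun measurableTypeR R >-> measurableTypeR R} :=
  HB.pack ((fun x => x - c) : measurableTypeR R -> measurableTypeR R)
    (isMeasurableFun.Build _ _ (measurableTypeR R) (measurableTypeR R) _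
      (measurable_shift c)).
apply: esym; apply: (@lebesgue_measure_unique _ (pushforward mu sc)) mA.
move=> _ [[a b]] _ <-.
rewrite /= /pushforward.
rewrite (_ : _ @^-1` _ = `]a + c, b + c]%classic); last first.
  by apply/seteqP; split=> x /=; rewrite !in_itv/= ltrBrDr lerBlDr.
rewrite !lebesgue_measure_itv/= !lte_fin ltrD2r; case: ifP => // _.
by congr (_%:E); ring.
Qed.

Lemma lebesgue_measure_reflect (c : R) (A : set R) : measurable A ->
  pushforward mu ((fun x => c - x) : _ -> measurableTypeR R) A = mu A.
Proof.
move=> mA; rewrite -[RHS](lebesgue_measureN mA).
rewrite -[RHS](lebesgue_measure_shift c) /pushforward.
  by congr (mu _); apply/seteqP; split => x /=; rewrite opprB.
by rewrite -[X in measurable X]setTI; exact: oppr_measurable.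
Qed.

Lemma ge0_integral_shift (c : R) (f : R -> \bar R) :
  measurable_fun setT f -> (forall x, 0 <= f x)%E ->
  (\int[mu]_x f (x - c)%R = \int[mu]_x f x)%E.
Proof.
move=> mf f0; rewrite -[LHS](@ge0_integral_pushforward _ _ (measurableTypeR R)
  (measurableTypeR R) _ _ (measurable_shift c) mu setT f)//.
apply: eq_measure_integral => [|? A mA _]; first exact: measurable_shift.
exact: (lebesgue_measure_shift c A mA).
Qed.

Lemma integral_shift (c : R) (f : R -> \bar R) :
  mu.-integrable setT f -> (\int[mu]_x f (x - c)%R = \int[mu]_x f x)%E.
Proof.
move=> /integrableP[mf _]; rewrite [LHS]integralE [RHS]integralE.
congr (_ - _)%E.
- rewrite -[RHS](ge0_integral_shift c f^\+%E (measurable_funepos mf)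
    (fun=> funepos_ge0 _ _)).
  by apply: eq_integral => x _; rewrite funepos_comp.
- rewrite -[RHS](ge0_integral_shift c f^\-%E (measurable_funeneg mf)
    (fun=> funeneg_ge0 _ _)).
  by apply: eq_integral => x _; rewrite funeneg_comp.
Qed.

Lemma integrable_shift (c : R) (f : R -> \bar R) :
  mu.-integrable setT f -> mu.-integrable setT (fun x => f (x - c)).
Proof.
move=> /integrableP[mf foo]; apply/integrableP; split.
  exact: (measurableT_comp mf (measurable_shift c)).
rewrite (ge0_integral_shift c (fun x => `|f x|)%E)//.
exact: measurableT_comp.
Qed.

(** A convolution evaluates its kernel at [t - r], so a property of the kernel at almost every point
    has to be carried over by [r |-> t - r], which preserves null sets. *)
Lemma ae_reflect (c : R) (P : set R) :
  {ae mu, forall x, P x} -> {ae mu, forall x, P (c - x)}.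
Proof.
move=> [N [mN N0 sN]]; exists ((fun x => c - x) @^-1` N); split.
- by rewrite -[X in measurable X]setTI; exact: measurable_reflect.
- exact: etrans (lebesgue_measure_reflect c N mN) N0.
- by move=> x nPx; exact: sN.
Qed.

End lebesgue_translation.

(** * Exchanging almost everywhere quantifiers on a product *)

Section ae_product.
Context d1 d2 (T1 : measurableType d1) (T2 : measurableType d2) {R : realType}.
Variables (m1 : {sigma_finite_measure set T1 -> \bar R}).
Variables (m2 : {sigma_finite_measure set T2 -> \bar R}).

Lemma ae_eq0_integral d (T : measurableType d) (m : {measure set T -> \bar R})
    (f : T -> \bar R) : measurable_fun setT f -> (forall x, 0 <= f x)%E ->
  (\int[m]_x f x = 0)%E <-> {ae m, forall x, f x = 0%E}.
Proof.
move=> mf f0; have /(ae_eq_integral_abs m measurableT) E := mf.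
have -> : (\int[m]_x f x = \int[m]_x `|f x|)%E.
  by apply: eq_integral => x _; rewrite gee0_abs.
by rewrite E; split; apply: filterS => x /=; [exact|move=> + _].
Qed.

(** Tonelli for the indicator of the complement of [A]: either quantified statement says that one of
    the two iterated integrals vanishes, and these are equal because [A] is jointly measurable. *)
Lemma ae_ae_swap (A : set (T1 * T2)) : measurable A ->
  {ae m2, forall y, {ae m1, forall x, A (x, y)}} ->
  {ae m1, forall x, {ae m2, forall y, A (x, y)}}.
Proof.
move=> mA H; pose f z : \bar R := (\1_(~` A) z)%:E.
have mf : measurable_fun setT f.
  by apply/measurable_EFinP/measurable_indic; exact: measurableC.
have f0 z : (0 <= f z)%E by rewrite lee_fin.
have fA z : f z = 0%E <-> A z.
  rewrite /f indicE; have [Az|Az] := pselect (A z); first by rewrite memNset.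
  by rewrite mem_set//; split => // -[/eqP]; rewrite oner_eq0.
have mx x : measurable_fun setT (fun y => f (x, y)).
  exact: (measurable_fun_pair2 _ mf).
have my y : measurable_fun setT (fun x => f (x, y)).
  exact: (measurable_fun_pair1 _ mf).
have : (\int[m1]_x \int[m2]_y f (x, y) = 0)%E.
  rewrite fubini_tonelli//; apply/ae_eq0_integral => //.
  - exact: (measurable_fun_fubini_tonelli_G f).
  - by move=> y; exact: integral_ge0.
  apply: filterS H => y Hy; apply/ae_eq0_integral => //.
  by apply: filterS Hy => x /fA.
move/(ae_eq0_integral _ _ _ _ (measurable_fun_fubini_tonelli_F f mf f0)
  (fun x => integral_ge0 _ (fun y _ => f0 (x, y)))).
apply: filterS => x /(ae_eq0_integral _ _ _ _ (mx x) (fun y => f0 (x, y))).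
by apply: filterS => y /fA.
Qed.

End ae_product.

(** * Kernels as tails of a finite measure *)

Lemma measurable_set_bool d (T : measurableType d) (b : T -> bool) :
  measurable_fun setT b -> measurable [set x | b x].
Proof.
by move=> mb; rewrite -[X in measurable X]setTI;
  exact: (mb measurableT [set true]).
Qed.

(** The finiteness structures are packed explicitly so that the image measure can serve as a factor
    in the Fubini and Tonelli theorems. *)
Lemma pushforward_finite_measure d d' (X : measurableType d)
    (Y : measurableType d') {R : realType} (m : {finite_measure set X -> \bar R})
    (f : X -> Y) : measurable_fun setT f ->
  exists nu : {finite_measure set Y -> \bar R},
    forall A, nu A = m (f @^-1` A).
Proof.
move=> mf.
have [pm pmE] : exists pm : {measure set Y -> \bar R},
    forall A, pm A = m (f @^-1` A).
  by unshelve eexists (pushforward m f : {measure set Y -> \bar R}).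
have pmfin : fin_num_fun pm.
  move=> A mA; rewrite pmE fin_num_measure//.
  by rewrite -[X in measurable X]setTI; exact: mf.
have pmsig : sigma_finite setT pm.
  by apply: fin_num_fun_sigma_finite; [rewrite measure0|exact: pmfin].
pose H1 := isFinite.Build _ _ _ _ pmfin.
pose H2 := isSFinite.Build _ _ _ _ (sfinite_measure_sigma_finite pmsig).
pose H3 := isSigmaFinite.Build _ _ _ _ pmsig.
by exists (HB.pack_for (FiniteMeasure.type Y R) (Measure.sort pm) H1 H2 H3).
Qed.

Section kernel_measure.
Context {R : realType} (T : R) (k : R -> R).
Hypothesis T0 : 0 < T.
Hypothesis k0 : forall t, t \in `[0, T] -> 0 <= k t.
Hypothesis kni : {in `[0, T] &, forall s t, s <= t -> k t <= k s}.
Local Notation mu := (@lebesgue_measure R).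

(** [tau] is the generalized inverse of [k]. The convention [sup set0 = 0] gives [tau l = 0] at
    levels [l] that [k] never exceeds on [[0, T]]. *)
Let S (l : R) : set R := [set r | r \in `[0, T] /\ l < k r].
Let tau (l : R) : R := sup (S l).

Let S_ub l : ubound (S l) T.
Proof. by move=> r [/itvP rT _]; rewrite rT. Qed.

Let S_le_tau l r : S l r -> r <= tau l.
Proof. by move=> Slr; apply: ub_le_sup => //; exists T; exact: S_ub. Qed.

Let tau_ge0 l : 0 <= tau l.
Proof.
have [S0|/set0P[r Slr]] := eqVneq (S l) set0; first by rewrite /tau S0 sup0.
by apply: le_trans (S_le_tau _ _ Slr); case: Slr => /itvP rT _; rewrite rT.
Qed.

Let tau_leT l : tau l <= T.
Proof.
have [S0|/set0P[r Slr]] := eqVneq (S l) set0; first by rewrite /tau S0 sup0 ltW.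
by apply: ge_sup; [exists r|exact: S_ub].
Qed.

Let tau_ni : nonincreasing_fun tau.
Proof.
move=> l l' ll'.
have [S0|/set0P[r Slr]] := eqVneq (S l') set0.
  by rewrite [in leLHS]/tau S0 sup0.
apply: ge_sup; first by exists r.
by move=> s [sT ls]; apply: S_le_tau; split => //; exact: le_lt_trans ls.
Qed.

Let measurable_tau : measurable_fun setT tau.
Proof. exact: nonincreasing_measurable. Qed.

(** Continuing [k] by its end values keeps it nonincreasing on the whole line, which yields
    measurability there. *)
Let kT (r : R) : R := k (Num.max 0 (Num.min r T)).

Let clampT r : Num.max 0 (Num.min r T) \in `[0, T].
Proof. by rewrite in_itv/= le_max lexx/= ge_max (ltW T0)/= ge_min lexx orbT. Qed.

Let kTE r : r \in `[0, T] -> kT r = k r.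
Proof.
by rewrite in_itv/= => /andP[r0 rT]; rewrite /kT (min_idPl rT) (max_idPr r0).
Qed.

Let measurable_kT : measurable_fun setT kT.
Proof.
apply: nonincreasing_measurable => // r s rs; apply: kni => //.
by rewrite ge_max le_max lexx/= le_max le_min !ge_min rs lexx !orbT.
Qed.

Let tau_eq r l : r \in `[0, T] -> l < k r -> tau l <= r -> r = tau l.
Proof. by move=> rT lk taur; apply/eqP; rewrite eq_le taur S_le_tau. Qed.

Let lt_tau r l : r \in `[0, T] -> r < tau l -> l < k r.
Proof.
move=> rT rtau; have [S0|/set0P Sl] := eqVneq (S l) set0.
  by move: rtau; rewrite /tau S0 sup0 ltNge (itvP rT).
have [s [sT ls] rs] := sup_gt Sl rtau.
by apply: lt_le_trans ls _; apply: kni => //; exact: ltW.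
Qed.

Lemma nonincreasing_measurable_extension :
  exists k1 : R -> R, measurable_fun setT k1 /\ {in `[0, T], k1 =1 k}.
Proof. by exists kT; split => // r; exact: kTE. Qed.

(* Layer cake: [k r] is the measure of [{l | 0 < l < k r}], and for each level
   [l] the set [{r | l < k r}] is an interval with end point [tau l], so that
   [nu] is the distribution of [tau] under the Lebesgue measure on [0, k 0]. *)
Lemma nonincreasing_kernel_measure :
  exists nu : {finite_measure set (measurableTypeR R) -> \bar R},
    nu (~` `[0, T]) = 0%E /\
    {ae mu, forall r, r \in `[0, T] -> nu `]r, +oo[%classic = (k r)%:E}.
Proof.
have mI : measurable (`]0, k 0[%classic : set (measurableTypeR R)).
  exact: measurable_itv.
have Ioo : (mu `]0%R, k 0[%classic < +oo)%E.
  by rewrite lebesgue_measure_itv/=; case: ifP => // _; rewrite -EFinB ltry.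
have [nu nuE] := pushforward_finite_measure _ _ _ (measurableTypeR R)
  (mfrestr mI Ioo) tau measurable_tau.
exists nu; split.
  rewrite nuE /= /mfrestr /mrestr/= (_ : _ `&` _ = set0) ?measure0//.
  rewrite -subset0 => l [/=]; rewrite in_itv/= => + _.
  by rewrite tau_ge0 tau_leT.
(* Outside [A], [k r] exceeds the level [l] although [tau l <= r]. By [tau_eq] this happens, for a
   given [l], at most at [r = tau l]; [ae_ae_swap] then shows that for almost every [r] the
   exceptional levels form a null set. *)
pose A : set (R * R) := [set z | ~~ [&& 0 <= z.1, z.1 <= T, 0 < z.2,
  z.2 < kT z.1 & tau z.2 <= z.1]].
have mA : measurable A.
  apply: measurable_set_bool; apply: measurable_neg.
  have m1 : measurable_fun setT (fst : R * R -> R) by [].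
  have m2 : measurable_fun setT (snd : R * R -> R) by [].
  have mk : measurable_fun setT (kT \o fst : R * R -> R).
    exact: measurableT_comp.
  have mt : measurable_fun setT (tau \o snd : R * R -> R).
    exact: measurableT_comp.
  by do 4 (apply: measurable_and;
    first by [apply: measurable_fun_ler|apply: measurable_fun_ltr]);
    apply: measurable_fun_ler.
have : {ae mu, forall r, {ae mu, forall l, A (r, l)}}.
  apply: (ae_ae_swap _ _ _ _ mu mu _ mA); apply: aeW => l.
  exists [set tau l]; split => //; first exact: lebesgue_measure_set1.
  move=> r /= /negP; rewrite negbK => /and5P[r0 rT l0 lk taur].
  have rI : r \in `[0, T] by rewrite in_itv/= r0.
  by apply: tau_eq => //; rewrite -kTE.
apply: ae_imply => r [N [mN N0 sN]] rI; rewrite nuE /= /mfrestr /mrestr.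
have kr0 : k r <= k 0.
  by apply: kni; rewrite ?in_itv/= ?lexx ?(ltW T0)// ?(itvP rI).
have mtr : measurable (tau @^-1` `]r, +oo[ `&` `]0, k 0[ : set R).
  apply: measurableI => //; rewrite -[X in measurable X]setTI.
  by apply: measurable_tau => //; exact: measurable_itv.
have <- : mu `]0, k r[%classic = (k r)%:E.
  rewrite lebesgue_measure_itv/= lte_fin; case: ltP => [_|kr].
    by rewrite oppr0 adde0.
  by congr (_%:E); apply/eqP; rewrite eq_le kr k0.
(* One inclusion between the two sets of levels is [lt_tau]; the other holds up to the null set [N]
   of exceptional levels. *)
apply/eqP; rewrite eq_le; apply/andP; split.
  apply: le_measure; rewrite ?inE// => l [/=].
  rewrite !in_itv/= andbT => rtau /andP[l0 _].
  by rewrite l0 lt_tau.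
rewrite (le_trans (y := mu ((tau @^-1` `]r, +oo[ `&` `]0, k 0[) `|` N)))//.
  apply: le_measure; rewrite ?inE//; first exact: measurableU.
  move=> l /=; rewrite !in_itv/= andbT => /andP[l0 lk].
  have [rtau|taur] := ltP r (tau l).
    by left; rewrite l0 (lt_le_trans lk).
  by right; apply: sN => /= /negP; apply; rewrite kTE// lk l0 taur !(itvP rI).
by rewrite -[leRHS]adde0 -N0; exact: measureU2.
Qed.

End kernel_measure.

(** * The convolution as a primitive *)

Section integrable_aux.
Context d (X : measurableType d) {R : realType}.
Variable m : {measure set X -> \bar R}.

Lemma integrable_if (b : X -> bool) (f : X -> R) : measurable_fun setT b ->
  m.-integrable setT (EFin \o f) ->
  m.-integrable setT (fun x => (if b x then f x else 0)%:E).
Proof.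
move=> mb fi; apply: (le_integrable measurableT _ _ fi).
  apply/measurable_EFinP; apply: measurable_fun_ifT => //.
  by apply/measurable_EFinP; exact: measurable_int fi.
by move=> x _ /=; case: ifP => //; rewrite normr0 lee_fin.
Qed.

Lemma integrable_fine (f : X -> \bar R) : m.-integrable setT f ->
  m.-integrable setT (EFin \o (fine \o f)).
Proof.
move=> fi; apply: (le_integrable measurableT _ _ fi).
  apply/measurable_EFinP; apply: measurableT_comp => //.
  exact: measurable_int fi.
by move=> x _ /=; case: (f x) => [r||] //=; rewrite ?normr0 leey.
Qed.

End integrable_aux.

Section delayed_difference.
Context {R : realType}.
Variable nu : {finite_measure set (measurableTypeR R) -> \bar R}.
Local Notation mu := (@lebesgue_measure R).

(** With [k r = nu ]r, +oo[] one has formally [k' = - nu] on positive times, and this is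
    [(k * w)' = k(0+) w - nu * w]; an atom of [nu] at 0 contributes nothing. *)
Definition delay_diff (w : R -> R) (r : R) : R := \int[nu]_s (w r - w (r - s)).

Section integrability.
Variable w : R -> R.
Hypothesis iw : mu.-integrable setT (EFin \o w).

Let mw : measurable_fun setT w.
Proof. by apply/measurable_EFinP; exact: measurable_int iw. Qed.

Let iw_lty : (\int[mu]_x `|(w x)%:E| * nu setT < +oo)%E.
Proof.
have /integrableP[_ ioo] := iw.
rewrite lte_mul_pinfty//; first exact: integral_ge0.
  by rewrite ge0_fin_numE//; exact: integral_ge0.
by rewrite ltey_eq fin_num_measure.
Qed.

(** For each delay [s] the translate of [w] has the same [L_1] norm as [w], and [nu] is finite. *)
Lemma integrable_delay :
  (mu \x nu)%E.-integrable setT (fun z : R * R => (w (z.1 - z.2))%:E).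
Proof.
apply/integrable21ltyP.
  apply/measurable_EFinP; apply: (measurableT_comp mw).
  exact: measurable_funB.
rewrite (eq_integral (cst (\int[mu]_x `|(w x)%:E|)%E)) ?integral_cst//.
move=> s _ /=; apply: (ge0_integral_shift s (fun x => `|(w x)%:E|)%E) => //.
by apply: measurableT_comp => //; exact: measurable_int iw.
Qed.

Lemma integrable_nodelay :
  (mu \x nu)%E.-integrable setT (fun z : R * R => (w z.1)%:E).
Proof.
apply/integrable21ltyP.
  by apply/measurable_EFinP; apply: (measurableT_comp mw).
by rewrite (eq_integral (cst (\int[mu]_x `|(w x)%:E|)%E)) ?integral_cst.
Qed.

Lemma integrable_delay_integrand :
  (mu \x nu)%E.-integrable setT (fun z : R * R => (w z.1 - w (z.1 - z.2))%:E).
Proof.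
under eq_fun do rewrite EFinB.
exact: integrableB integrable_nodelay integrable_delay.
Qed.

Lemma integrable_delay_diff : mu.-integrable setT (EFin \o delay_diff w).
Proof.
exact: integrable_fine (integrable_fubini_F integrable_delay_integrand).
Qed.

(** The [fine] hidden in the real-valued integral loses nothing at almost every [r], since the inner
    integral given by Fubini is finite there. *)
Lemma delay_diffE :
  {ae mu, forall r, (\int[nu]_s (w r - w (r - s))%:E)%E = (delay_diff w r)%:E}.
Proof.
have := integrable_ae measurableT (integrable_fubini_F integrable_delay_integrand).
by apply: ae_imply => r /(_ I) rfin; rewrite /delay_diff /Rintegral fineK.
Qed.

End integrability.

Section primitive.
Variables (T : R) (k w : R -> R).
Hypothesis mk : measurable_fun setT k.
Hypothesis nuT : nu (~` `[0, T]) = 0%E.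
Hypothesis nuk :
  {ae mu, forall r, r \in `[0, T] -> nu `]r, +oo[%classic = (k r)%:E}.
Hypothesis iw : mu.-integrable setT (EFin \o w).
Hypothesis w0 : forall s, s < 0 -> w s = 0.

Let mw : measurable_fun setT w.
Proof. by apply/measurable_EFinP; exact: measurable_int iw. Qed.

Let ae_nu : {ae nu, forall s, s \in `[0, T]}.
Proof. by exists (~` `[0, T]); split => //; exact: measurableC. Qed.

(** Fubini is applied twice. For a fixed delay [s], the integral of [w] over []t - s, t]] equals
    that of [w r - w (r - s)] over [[0, t]], because [w] vanishes at negative times. *)
Lemma time_conv_primitive t : t \in `[0, T] ->
  time_conv k w t = \int[mu]_(r in `[0, t]) delay_diff w r.
Proof.
move=> tT; rewrite /time_conv /Rintegral; congr fine.
(* Integrating [h] in the delay first produces [w r * nu ]t - r, +oo[], which is the integrand of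
   the convolution; integrating [G] in the delay first produces [delay_diff w r] on [[0, t]]. *)
pose h (z : R * R) :=
  if [&& 0 <= z.1, z.1 <= t & t - z.1 < z.2] then w z.1 else 0.
pose G (z : R * R) :=
  if (0 <= z.1) && (z.1 <= t) then w z.1 - w (z.1 - z.2) else 0.
have m1 : measurable_fun setT (fst : R * R -> R) by [].
have m2 : measurable_fun setT (snd : R * R -> R) by [].
have ih : (mu \x nu)%E.-integrable setT (EFin \o h).
  apply: integrable_if; last exact: integrable_nodelay.
  do 2 (apply: measurable_and; first exact: measurable_fun_ler).
  by apply: measurable_fun_ltr => //; exact: measurable_funB.
have iG : (mu \x nu)%E.-integrable setT (EFin \o G).
  apply: integrable_if; last exact: integrable_delay_integrand.
  by apply: measurable_and; exact: measurable_fun_ler.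
transitivity (\int[mu]_r \int[nu]_s (h (r, s))%:E)%E.
  rewrite integral_mkcond; apply: ae_eq_integral => //.
  - apply/(measurable_restrictT _ _).1 => //.
    apply/measurable_EFinP; apply: measurable_funTS.
    apply: measurable_funM => //; apply: measurableT_comp => //.
    exact: measurable_funB.
  - exact: (measurable_fubini_F ih).
  have : {ae mu, forall r, r \in `[0, T] -> nu `]r, +oo[%classic = (k r)%:E}.
    exact: nuk.
  move=> /(ae_reflect t); apply: ae_imply => r nukr _.
  rewrite patchE; case: ifPn => [|rt]; last first.
    rewrite integral0_eq// => s _; rewrite /h/=.
    case: ifPn => // /and3P[r0 rt' _].
    by move: rt; rewrite notin_setE/= in_itv/= r0 rt'.
  rewrite inE/= in_itv/= => /andP[r0 rt].
  transitivity (\int[nu]_s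
      ((w r)%:E * (\1_(`]t - r, +oo[%classic : set (measurableTypeR R)) s)%:E))%E;
    last first.
    apply: eq_integral => s _.
    rewrite /h/= r0 rt/= indicE mem_setE in_itv/= andbT -EFinM.
    by case: ifP; rewrite (mulr1, mulr0).
  rewrite integralZl//; last first.
    by apply: integrable_indic => //; rewrite ltey_eq fin_num_measure.
  rewrite integral_indic// setIT [X in _ = (_ * X)%E]nukr ?EFinM 1?muleC//.
  by rewrite in_itv/= subr_ge0 rt lerBlDr (le_trans (y := T)) ?lerDl// (itvP tT).
rewrite (Fubini ih).
transitivity (\int[nu]_s \int[mu]_r (G (r, s))%:E)%E.
  apply: ae_eq_integral => //.
  - exact: (measurable_fubini_G ih).
  - exact: (measurable_fubini_G iG).
  apply: ae_imply ae_nu => s sT _.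
  (* [h (r, s)] is [P r - C r]: for [r < 0] everything vanishes by [w0]. Translating [C] by [s]
     moves its cut-off from [t - s] to [t] and turns it into the delayed term of [G]. *)
  pose C (r : R) := if r <= t - s then w r else 0.
  pose P (r : R) := if r <= t then w r else 0.
  have iC : mu.-integrable setT (EFin \o C).
    by apply: integrable_if => //; exact: measurable_fun_ler.
  have iP : mu.-integrable setT (EFin \o P).
    by apply: integrable_if => //; exact: measurable_fun_ler.
  transitivity (\int[mu]_r ((P r)%:E - (C r)%:E))%E.
    apply: eq_integral => r _; rewrite /h /P /C/= -EFinB; congr EFin.
    rewrite ltrBlDr addrC -ltrBlDr.
    have [r0|r0] /= := ltP r 0; first by rewrite w0// !if_same subr0.
    have [rts|rts] := leP r (t - s).
      by rewrite (le_trans rts) ?subrr ?if_same// lerBlDr lerDl (itvP sT).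
    by rewrite subr0 andbT.
  rewrite integralB//.
  rewrite -(integral_shift s (fun r => (C r)%:E))// -integralB//; last first.
    exact: (integrable_shift s (fun r => (C r)%:E)).
  apply: eq_integral => r _; rewrite /G /P /C/= -EFinB; congr EFin.
  rewrite lerD2r.
  have [r0|r0] /= := ltP r 0.
    rewrite !w0// ?if_same ?subr0//.
    by rewrite ltrBlDr (lt_le_trans r0)// add0r (itvP sT).
  by case: ifP => _ //; rewrite subr0.
rewrite -(Fubini iG) [RHS]integral_mkcond.
apply: ae_eq_integral => //.
- exact: (measurable_fubini_F iG).
- apply/(measurable_restrictT _ _).1 => //; apply: measurable_funTS.
  exact: measurable_int (integrable_delay_diff _ iw).
apply: ae_imply (delay_diffE _ iw) => r rE _.
rewrite patchE -rE; case: ifPn => rt.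
  by apply: eq_integral => s _; move: rt; rewrite inE/= in_itv/= /G/= => ->.
rewrite integral0_eq// => s _; move: rt; rewrite notin_setE/= in_itv/= /G/=.
by move=> /negP/negbTE ->.
Qed.


(** The fundamental theorem of calculus at almost every point, applied to the primitive from
    [time_conv_primitive]; the two functions agree near each interior [t]. *)
Lemma time_conv_derive : {ae mu, forall t, t \in `]0, T[ ->
  derivable (time_conv k w) t 1 /\ derive1 (time_conv k w) t = delay_diff w t}.
Proof.
have iD := integrable_delay_diff _ iw.
have iDS (A : set R) : measurable A -> mu.-integrable A (EFin \o delay_diff w).
  by move=> mA; apply: integrableS iD.
have := @FTC1 R (delay_diff w) (BLeft 0) (fun y => iDS _ (measurable_itv _))
  (open_integrable_locally openT iD).
apply: ae_imply => t dD tT; have [] := dD.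
  by rewrite lte_fin (itvP tT).
have near_eq : \forall s \near t,
    \int[mu]_(r in `[0, s]) delay_diff w r = time_conv k w s.
  near=> s; rewrite time_conv_primitive//.
  suff : s \in `]0, T[ by exact: subset_itv_oo_cc.
  by near: s; exact: near_in_itvoo.
move=> dF FD; split; first exact: near_eq_derivable near_eq dF.
by rewrite -FD !derive1E; apply/esym/near_eq_derive.
Unshelve. all: by end_near. Qed.

(** Supplies the continuity under which rational increments suffice in [derive1_ratP]. *)
Lemma time_conv_continuous :
  {in `]0, T[, forall t, {for t, continuous (time_conv k w)}}.
Proof.
move=> t tT; have T0 : 0 < T.
  by move: tT; rewrite in_itv/= => /andP[]; exact: lt_trans.
have iD : mu.-integrable `[0, T] (EFin \o delay_diff w).
  by apply: integrableS (integrable_delay_diff _ iw).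
have := parameterized_integral_continuous (ltW T0) iD.
move/(continuous_within_itvP _ T0) => [cF _ _].
have := cF t tT; rewrite /prop_for /continuous_at /parameterized_integral/=.
have near_eq : \forall s \near t,
    \int[mu]_(r in `[0, s]) delay_diff w r = time_conv k w s.
  near=> s; rewrite time_conv_primitive//.
  suff : s \in `]0, T[ by exact: subset_itv_oo_cc.
  by near: s; exact: near_in_itvoo.
by rewrite (nbhs_singleton near_eq); apply: cvg_trans; exact: near_eq_cvg.
Unshelve. all: by end_near. Qed.

End primitive.
End delayed_difference.

(** * Differentiability tested on rational increments *)

Section real_derivative.
Context {R : realType}.

Lemma ge0_rat_dense (g : R -> R) (a b : R) :
  {in `]a, b[, forall h, {for h, continuous g}} ->
  (forall q : rat, ratr q \in `]a, b[ -> 0 <= g (ratr q)) ->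
  {in `]a, b[, forall h, 0 <= g h}.
Proof.
move=> cg gq h hab; rewrite leNgt; apply/negP => gh.
have : \forall y \near h, g y < 0 /\ y \in `]a, b[.
  near=> y; split; last by near: y; exact: near_in_itvoo.
  by near: y; exact: cvgr_lt (cg h hab) _ gh.
move=> /nbhs_ballP[e /= e0 he].
have [q] : exists q : rat, ratr q \in `]h - e, h + e[.
  by apply: rat_in_itvoo; rewrite ltrBlDr -addrA ltrDl addr_gt0.
rewrite in_itv/= => /andP[q1 q2].
have [] := he (ratr q).
  by rewrite /ball/= distrC ltr_distl q1.
by move=> gq0 qab; move: (gq q qab); rewrite leNgt gq0.
Unshelve. all: by end_near. Qed.

Lemma derive1_cvgP (F : R -> R) (t D : R) :
  (derivable F t 1 /\ derive1 F t = D) <->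
  h^-1 *: (F (h + t) - F t) @[h --> 0^'] --> D.
Proof.
have E : (fun h => h^-1 *: ((F \o shift t) (h *: 1) - F t)) =
    (fun h : R => h^-1 *: (F (h + t) - F t)).
  by apply/funext => h /=; congr (_ *: (F (_ + t) - _)); exact: mulr1.
rewrite /derivable E /derive1; split; first by move=> [cv <-].
by move=> cv; split; [apply/cvg_ex; exists D|exact/cvg_lim].
Qed.

(** The right-hand side involves only countable quantifiers, so it defines a measurable set when [F]
    and [D] depend measurably on a parameter. By continuity of [F], an estimate on rational
    increments extends to all small ones. *)
Lemma derive1_ratP (F : R -> R) (t D a b : R) : t \in `]a, b[ ->
  {in `]a, b[, forall s, {for s, continuous F}} ->
  (derivable F t 1 /\ derive1 F t = D) <->
  forall n : nat, exists m : nat, forall q : rat,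
    `|ratr q| < m.+1%:R^-1 :> R ->
    `|F (ratr q + t) - F t - ratr q * D| <= `|ratr q| * n.+1%:R^-1 :> R.
Proof.
move=> tab cF; rewrite derive1_cvgP; split.
  move=> /cvgrPdist_lt cv n.
  have /cv/nbhs_ballP[e /= e0 He] : 0 < n.+1%:R^-1 :> R by rewrite invr_gt0.
  have [m me] : exists m : nat, m.+1%:R^-1 < e.
    by have [m _ /(_ _ (leqnn m))] := near_infty_natSinv_lt (PosNum e0); exists m.
  exists m => q qm; have [->|q0] := eqVneq (ratr q : R) 0.
    by rewrite add0r subrr mul0r subr0 normr0 mul0r.
  have : `|D - (ratr q)^-1 *: (F (ratr q + t) - F t)| < n.+1%:R^-1.
    by apply: He => //; rewrite /ball/= sub0r normrN (lt_trans qm).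
  move=> /ltW /(ler_wpM2l (normr_ge0 (ratr q))); apply: le_trans.
  rewrite -normrM mulrBr /GRing.scale/= mulrA mulfV// mul1r.
  by rewrite [leRHS]distrC.
move=> H; apply/cvgrPdist_le => e e0.
have [n ne] : exists n : nat, n.+1%:R^-1 < e.
  by have [m _ /(_ _ (leqnn m))] := near_infty_natSinv_lt (PosNum e0); exists m.
have [m Hm] := H n.
(* Increments below [d] satisfy the test for [m] and keep [h + t] inside []a, b[], where [F] is
   continuous. *)
pose d := Num.min m.+1%:R^-1 (Num.min (t - a) (b - t)).
have [ta tb] : a < t /\ t < b by move: tab; rewrite in_itv/= => /andP.
have d0 : 0 < d by rewrite !lt_min invr_gt0 ltr0n/= !subr_gt0 ta.
have dab h : h \in `]- d, d[ -> h + t \in `]a, b[.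
  rewrite !in_itv/= => /andP[]; rewrite ltrNl !lt_min => /and3P[_ h1 _].
  move=> /and3P[_ _ h2].
  by rewrite -ltrBlDr -opprB ltrNl h1 -ltrBrDr.
(* The estimate multiplied by [|h|]: without the division by [h], [g] is continuous at 0 as well. *)
pose g h := `|h| * n.+1%:R^-1 - `|F (h + t) - F t - h * D|.
have g0 : {in `]- d, d[, forall h, 0 <= g h}.
  apply: ge0_rat_dense.
    move=> h hd; apply: cvgB.
      by apply: cvgM; [exact: cvg_norm|exact: cvg_cst].
    apply: cvg_norm; apply: cvgB; last by apply: cvgM; [|exact: cvg_cst].
    apply: cvgB; last exact: cvg_cst.
    apply: continuous_comp; last exact: cF (dab _ hd).
    by apply: cvgD; [|exact: cvg_cst].
  move=> q; rewrite in_itv/= => /andP[q1 q2]; rewrite subr_ge0; apply: Hm.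
  have : `|ratr q| < d by rewrite ltr_norml q1.
  by rewrite lt_min => /andP[].
near=> h.
have h0 : h != 0 by near: h; exact: nbhs_dnbhs_neq.
have hd : h \in `]- d, d[.
  rewrite in_itv/= -ltr_norml; near: h; exact: dnbhs0_lt.
have hn0 : 0 < `|h| by rewrite normr_gt0.
rewrite (le_trans _ (ltW ne))// -(ler_pM2l hn0).
move: (g0 h hd); rewrite subr_ge0; apply: le_trans.
rewrite -normrM mulrBr /GRing.scale/= mulrA mulfV// mul1r.
by rewrite [leLHS]distrC.
Unshelve. all: by end_near. Qed.

End real_derivative.

(** * The derivative of the convolution with a parameter *)

Section integral_param.
Context d1 d2 (Z : measurableType d1) (Y : measurableType d2) {R : realType}.
Variable m : {sigma_finite_measure set Y -> \bar R}.

(** Tonelli gives measurability for the positive and the negative part separately. *)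
Lemma measurable_integral_param (f : Z * Y -> \bar R) :
  measurable_fun setT f -> measurable_fun setT (fun z => \int[m]_y f (z, y))%E.
Proof.
move=> mf; rewrite (_ : (fun z => \int[m]_y f (z, y))%E =
    ((fun z => \int[m]_y f^\+ (z, y)) \- (fun z => \int[m]_y f^\- (z, y)))%E).
  by apply: emeasurable_funB; apply: measurable_fun_fubini_tonelli_F => //;
    [exact: measurable_funepos|exact: measurable_funeneg].
apply/funext => z; rewrite [LHS]integralE.
under eq_integral do rewrite funepos_comp/=.
by under [X in (_ - X)%E = _]eq_integral do rewrite funeneg_comp/=.
Qed.

Lemma measurable_Rintegral_param (f : Z * Y -> R) :
  measurable_fun setT f -> measurable_fun setT (fun z => \int[m]_y f (z, y)).
Proof.
move=> mf; apply: (@measurableT_comp _ _ _ _ _ _ fine) => //.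
by apply: (measurable_integral_param (EFin \o f)); exact/measurable_EFinP.
Qed.

End integral_param.

Section joint_derivative.
Context d (X : measurableType d) {R : realType}.
Variable mX : {sigma_finite_measure set X -> \bar R}.
Variable nu : {finite_measure set (measurableTypeR R) -> \bar R}.
Local Notation mu := (@lebesgue_measure R).
Variables (T : R) (k : R -> R) (w : R * X -> R).
Hypothesis mk : measurable_fun setT k.
Hypothesis nuT : nu (~` `[0, T]) = 0%E.
Hypothesis nuk :
  {ae mu, forall r, r \in `[0, T] -> nu `]r, +oo[%classic = (k r)%:E}.
Hypothesis mw : measurable_fun setT w.

Lemma measurable_delay_diff :
  measurable_fun setT (fun z => delay_diff nu (fun s => w (s, z.2)) z.1).
Proof.
apply: (@measurable_Rintegral_param _ _ (R * X)%type (measurableTypeR R) R nu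
  (fun z => w (z.1.1, z.1.2) - w (z.1.1 - z.2, z.1.2))).
have m11 : measurable_fun setT (fun z : R * X * measurableTypeR R => z.1.1).
  exact: measurableT_comp.
have m12 : measurable_fun setT (fun z : R * X * measurableTypeR R => z.1.2).
  exact: measurableT_comp.
apply: measurable_funB; apply: (measurableT_comp mw).
  exact/measurable_fun_pairP.
apply/measurable_fun_pairP; split => //.
exact: measurable_funB.
Qed.

Lemma measurable_time_conv :
  measurable_fun setT (fun z => time_conv k (fun s => w (s, z.2)) z.1).
Proof.
(* The domain [[0, t]] varies with the parameter, so it is moved into the integrand. *)
pose f (z : R * X * measurableTypeR R) : R :=
  if (0 <= z.2) && (z.2 <= z.1.1) then k (z.1.1 - z.2) * w (z.2, z.1.2) else 0.
have m11 : measurable_fun setT (fun z : R * X * measurableTypeR R => z.1.1).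
  exact: measurableT_comp.
have m12 : measurable_fun setT (fun z : R * X * measurableTypeR R => z.1.2).
  exact: measurableT_comp.
have m2 : measurable_fun setT
  ((fun z => z.2) : R * X * measurableTypeR R -> R) by exact: measurable_snd.
rewrite [X in measurable_fun _ X](_ : _ = fun z => \int[mu]_s f (z, s)).
  apply: measurable_Rintegral_param; apply: measurable_fun_ifT => //.
    by apply: measurable_and; exact: measurable_fun_ler.
  apply: measurable_funM.
    by apply: (measurableT_comp mk); exact: measurable_funB.
  by apply: (measurableT_comp mw); apply/measurable_fun_pairP.
apply/funext => -[t x]; rewrite /time_conv Rintegral_mkcond.
apply: eq_Rintegral => s _; rewrite patchE /f/=.
by rewrite mem_setE in_itv.
Qed.

Hypothesis w0 : forall s x, s < 0 -> w (s, x) = 0.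
Hypothesis iw : {ae mX, forall x, mu.-integrable setT (fun s => (w (s, x))%:E)}.

Lemma ae_time_conv_derive : {ae mu, forall t, t \in `]0, T[ ->
  {ae mX, forall x, derive1 (time_conv k (fun s => w (s, x))) t =
                    delay_diff nu (fun s => w (s, x)) t}}.
Proof.
pose F (z : R * X) := time_conv k (fun s => w (s, z.2)) z.1.
pose D (z : R * X) := delay_diff nu (fun s => w (s, z.2)) z.1.
(* The test of [derive1_ratP] at [z], made vacuous for times outside []0, T[], so that [A] holds
   there trivially and the swap runs over all times. *)
pose b (n m : nat) (q : rat) (z : R * X) : bool :=
  [&& 0 < z.1, z.1 < T & `|ratr q| < m.+1%:R^-1 :> R] ==>
  (`|F (ratr q + z.1, z.2) - F z - ratr q * D z| <= `|ratr q| * n.+1%:R^-1).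
pose A : set (R * X) :=
  \bigcap_n \bigcup_m \bigcap_(q : rat) [set z | b n m q z].
have mb n m q : measurable [set z | b n m q z].
  apply: measurable_set_bool; rewrite /b; under eq_fun do rewrite implybE.
  have m1 : measurable_fun setT (fst : R * X -> R) by [].
  apply: measurable_or.
    apply: measurable_neg; apply: measurable_and; first exact: measurable_fun_ltr.
    by apply: measurable_and => //; exact: measurable_fun_ltr.
  apply: measurable_fun_ler => //; apply: measurableT_comp => //.
  apply: measurable_funB.
    apply: measurable_funB; last exact: measurable_time_conv.
    have mq : measurable_fun setT (fun z : R * X => (ratr q + z.1, z.2)).
      apply: measurable_fun_pair => //.
      exact: (measurable_funD (f := cst (ratr q)) (g := fst)).
    exact: (measurableT_comp measurable_time_conv mq).
  by apply: measurable_funM => //; exact: measurable_delay_diff.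
have mA : measurable A.
  apply: bigcap_measurableType => n _; apply: bigcup_measurable => m _.
  rewrite -[X in measurable X]setCK setC_bigcap; apply: measurableC.
  by apply: bigcupT_measurable_rat => q; exact: measurableC.
have AP t x : t \in `]0, T[ -> mu.-integrable setT (fun s => (w (s, x))%:E) ->
    A (t, x) <-> (derivable (time_conv k (fun s => w (s, x))) t 1 /\
      derive1 (time_conv k (fun s => w (s, x))) t =
      delay_diff nu (fun s => w (s, x)) t).
  move=> tT iwx; rewrite (derive1_ratP _ _ _ 0 T tT); last first.
    by apply: (time_conv_continuous nu) => // s; exact: w0.
  move: (tT); rewrite in_itv/= => t0T; split.
    move=> H n; have [m _ Hm] := H n I; exists m => q qm.
    by have := Hm q I; rewrite /b/= andbA t0T qm.
  move=> H n _; have [m Hm] := H n; exists m => // q _.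
  by rewrite /b/= andbA t0T/=; apply/implyP => qm; exact: Hm.
have : {ae mu, forall t, {ae mX, forall x, A (t, x)}}.
  apply: (ae_ae_swap _ _ _ _ mu mX _ mA).
  apply: ae_imply iw => x iwx.
  have := time_conv_derive nu T k (fun s => w (s, x)) mk nuT nuk iwx
    (fun s => w0 s x).
  apply: ae_imply => t Ht.
  have [tT|tT] := boolP (t \in `]0, T[); first by apply/AP => //; exact: Ht.
  move=> n _; exists 0%N => // q _; rewrite /b/= andbA; move: tT.
  by rewrite in_itv/= => /negbTE ->.
apply: ae_imply => t At tT; apply: ae_imply2 At iw => x Atx iwx.
by have [] := (AP t x tT iwx).1 Atx.
Qed.

End joint_derivative.

(** * The inequality at a fixed time *)

Section Lnorm_param.
Context d1 d2 (Y : measurableType d1) (X : measurableType d2) {R : realType}.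
Variables (mu : {sigma_finite_measure set X -> \bar R}) (p : R).

Lemma measurable_Lnorm_param (b : Y * X -> R) : measurable_fun setT b ->
  measurable_fun setT (fun s => 'N[mu]_p%:E[EFin \o (fun x => b (s, x))]%E).
Proof.
move=> mb; rewrite unlock.
apply: (measurableT_comp (measurable_poweR _)).
apply: (measurable_fun_fubini_tonelli_F (fun z => `|(b z)%:E| `^ p)%E).
  apply: (measurableT_comp (measurable_poweR _)).
  by apply: measurableT_comp => //; exact/measurable_EFinP.
by move=> z; exact: poweR_ge0.
Qed.

End Lnorm_param.

(** * Hoelder's inequality integrated over the delays *)

Section duality_inequality.
Context d1 d2 (Y : measurableType d1) (X : measurableType d2) {R : realType}.
Variables (mu : {sigma_finite_measure set X -> \bar R}).
Variables (nu : {finite_measure set Y -> \bar R}) (p : R).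
Hypothesis cmu : measure_is_complete mu.
Hypothesis p1 : 1 < p.

Local Notation N f := ('N[mu]_p%:E[EFin \o f]%E).

Let p0 : 0 < p. Proof. exact: lt_trans p1. Qed.
Let pn0 : p != 0. Proof. by rewrite gt_eqF. Qed.
Let pB0 : 0 < p - 1. Proof. by rewrite subr_gt0. Qed.

Lemma integral_powR_Lnorm (a : X -> R) n : N a = n%:E ->
  (\int[mu]_x (`|a x| `^ p)%:E)%E = (n `^ p)%:E.
Proof.
by move=> an; rewrite -poweR_EFin -an poweR_Lnorm.
Qed.

(** With the conjugate exponent [q = p / (p - 1)] one has [(p - 1) * q = p], so the [L_q] norm of
    [|a| ^ (p - 1)] is [n ^ (p - 1)]. *)
Lemma hoelder_powR (a c : X -> R) n : measurable_fun setT a ->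
  measurable_fun setT c -> N a = n%:E ->
  (\int[mu]_x (`|a x| `^ (p - 1) * `|c x|)%:E <= (n `^ (p - 1))%:E * N c)%E.
Proof.
move=> ma mc an.
pose q := p / (p - 1).
have q0 : 0 < q by rewrite divr_gt0.
have qp : q^-1 + p^-1 = 1.
  by rewrite invf_div -[X in _ + X]mul1r -mulrDl subrK mulfV.
have ma1 : measurable_fun setT (fun x => `|a x| `^ (p - 1)).
  apply: (measurableT_comp (measurable_powR _)).
  exact: measurableT_comp.
have := hoelder mu ma1 mc q0 p0 qp; rewrite Lnorm1.
rewrite (eq_integral (fun x => (`|a x| `^ (p - 1) * `|c x|)%:E)); last first.
  by move=> x _ /=; rewrite normrM (ger0_norm (powR_ge0 _ _)).
suff -> : ('N[mu]_q%:E[EFin \o (fun x => `|a x| `^ (p - 1))%R])%E =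
  (n `^ (p - 1))%:E by [].
have n0 : 0 <= n by rewrite -lee_fin -an Lnorm_ge0.
rewrite unlock (_ : (\int[mu]_x _)%E = (n `^ p)%:E).
  rewrite poweR_EFin -powRrM /q invf_div mulrCA mulfV// mulr1//.
rewrite -(integral_powR_Lnorm _ _ an); apply: eq_integral => x _ /=.
rewrite (ger0_norm (powR_ge0 _ _)) -powRrM /q.
by rewrite mulrCA mulfV ?gt_eqF// mulr1.
Qed.

Variables (a g : X -> R) (b : Y * X -> R).
Hypothesis ma : measurable_fun setT a.
Hypothesis mb : measurable_fun setT b.
Hypothesis Na : (N a < +oo)%E.
Hypothesis Nb : (\int[nu]_s N (fun x => b (s, x)) < +oo)%E.
Hypothesis gE : {ae mu, forall x, g x = \int[nu]_s (a x - b (s, x))}.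

Let K := fine (nu setT).
Let KE : nu setT = K%:E.
Proof. by rewrite fineK// fin_num_measure. Qed.

Let K0 : 0 <= K. Proof. exact/fine_ge0/measure_ge0. Qed.

Let n := fine (N a).
Let nE : N a = n%:E.
Proof. by rewrite fineK// ge0_fin_numE// Lnorm_ge0. Qed.

(** Formally [f x * G x] is [Ax x] minus [f x] times the [nu]-integral of [b (s, x)], and [Bx x]
    bounds the last term in absolute value. *)
Let J x := (\int[nu]_s `|(b (s, x))%:E|)%E.
Let Bx x := ((`|a x| `^ (p - 1))%:E * J x)%E.
Let Ax x := (K * `|a x| `^ p)%:E.
Let f x := `|a x| `^ (p - 2) * a x.
Let G x := \int[nu]_s (a x - b (s, x)).

Let normf x : `|f x| = `|a x| `^ (p - 1).
Proof.
rewrite /f normrM (ger0_norm (powR_ge0 _ _)).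
(* The addition rule for exponents requires a nonzero base; at 0 both sides vanish because
   [p - 1 > 0]. *)
have [->|a0] := eqVneq (a x) 0; first by rewrite normr0 mulr0 powR0// gt_eqF.
rewrite -[X in _ * X]powRr1// -powRD; last by rewrite normr_eq0 a0 implybT.
by congr (_ `^ _); ring.
Qed.

Let fa x : f x * a x = `|a x| `^ p.
Proof.
rewrite /f -mulrA -expr2 -[a x ^+ 2]ger0_norm ?sqr_ge0// normrX.
have [->|a0] := eqVneq (a x) 0.
  by rewrite normr0 expr0n/= mulr0 powR0.
rewrite -powR_mulrn// -powRD; last by rewrite normr_eq0 a0 implybT.
by congr (_ `^ _); rewrite addrNK.
Qed.

Let mabsb : measurable_fun setT (fun z : Y * X => `|(b z)%:E|%E).
Proof. by apply: measurableT_comp => //; exact/measurable_EFinP. Qed.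

Let J_ge0 x : (0 <= J x)%E. Proof. exact: integral_ge0. Qed.

Let mJ : measurable_fun setT J.
Proof. exact: (measurable_fun_fubini_tonelli_G (fun z => `|(b z)%:E|%E)). Qed.

Let ma1 : measurable_fun setT (fun x => `|a x| `^ (p - 1)).
Proof.
by apply: (measurableT_comp (measurable_powR _)); exact: measurableT_comp.
Qed.

Let mB : measurable_fun setT Bx.
Proof. by apply: emeasurable_funM => //; exact/measurable_EFinP. Qed.

Let mA : measurable_fun setT Ax.
Proof.
apply/measurable_EFinP; apply: measurable_funM => //.
by apply: (measurableT_comp (measurable_powR _)); exact: measurableT_comp.
Qed.

Let intA : (\int[mu]_x Ax x)%E = (K * n `^ p)%:E.
Proof.
rewrite /Ax; under eq_integral do rewrite EFinM.
rewrite ge0_integralZl_EFin//.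
- by rewrite (integral_powR_Lnorm _ _ nE).
- apply/measurable_EFinP.
  by apply: (measurableT_comp (measurable_powR _)); exact: measurableT_comp.
Qed.

(** Tonelli puts the delay outside, and [hoelder_powR] applies for each fixed delay. *)
Let intB : (\int[mu]_x Bx x <=
  (n `^ (p - 1))%:E * \int[nu]_s N (fun x => b (s, x)))%E.
Proof.
pose h (z : Y * X) : \bar R := (`|a z.2| `^ (p - 1) * `|b z|)%:E.
have mh : measurable_fun setT h.
  apply/measurable_EFinP; apply: measurable_funM.
    by apply: (measurableT_comp ma1).
  exact: measurableT_comp.
have h0 z : (0 <= h z)%E by rewrite lee_fin mulr_ge0// powR_ge0.
rewrite (_ : (\int[mu]_x Bx x = \int[mu]_x \int[nu]_s h (s, x))%E); last first.
  apply: eq_integral => x _; rewrite /Bx /J -ge0_integralZl_EFin ?powR_ge0//.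
  exact: (measurable_fun_pair1 _ mabsb).
rewrite -(fubini_tonelli h mh h0) -ge0_integralZl_EFin ?powR_ge0//; last 2 first.
- by move=> s _; exact: Lnorm_ge0.
- exact: measurable_Lnorm_param.
apply: ge0_le_integral => //.
- by move=> s _; exact: integral_ge0.
- exact: (measurable_fun_fubini_tonelli_F h).
- by apply: emeasurable_funM => //; exact: measurable_Lnorm_param.
- move=> s _; apply: hoelder_powR => //.
  exact: (measurable_fun_pair2 _ mb).
Qed.

Let M := fine (\int[nu]_s N (fun x => b (s, x)))%E.
Let ME : (\int[nu]_s N (fun x => b (s, x)))%E = M%:E.
Proof.
by rewrite fineK// ge0_fin_numE//; apply: integral_ge0 => s _; exact: Lnorm_ge0.
Qed.

Let iA : mu.-integrable setT Ax.
Proof.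
apply/integrableP; split => //; rewrite (eq_integral Ax); first by rewrite intA ltry.
by move=> x _; rewrite gee0_abs// lee_fin mulr_ge0// powR_ge0.
Qed.

Let B_ge0 x : (0 <= Bx x)%E.
Proof. by rewrite mule_ge0// lee_fin powR_ge0. Qed.

Let iB : mu.-integrable setT Bx.
Proof.
apply/integrableP; split => //; rewrite (eq_integral Bx); last first.
  by move=> x _; rewrite gee0_abs.
by rewrite (le_lt_trans intB)// ME -EFinM ltry.
Qed.

Let mG : measurable_fun setT G.
Proof.
apply: (@measurable_Rintegral_param _ _ X Y R nu (fun z => a z.1 - b (z.2, z.1))).
apply: measurable_funB; first exact: (measurableT_comp ma measurable_fst).
apply: (measurableT_comp mb (g := fun z => (z.2, z.1))).
exact: measurable_fun_pair.
Qed.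

Let mf : measurable_fun setT f.
Proof.
apply: measurable_funM => //.
by apply: (measurableT_comp (measurable_powR _)); exact: measurableT_comp.
Qed.

Let bound x : (Ax x - Bx x <= (f x * G x)%:E /\
  `|(f x * G x)%:E| <= `|Ax x + Bx x|)%E.
Proof.
rewrite [X in (_ <= X)%E /\ _]/= (gee0_abs (x := (Ax x + Bx x)%E)); last first.
  by rewrite adde_ge0// lee_fin mulr_ge0// powR_ge0.
(* If [Bx x] is infinite, the lower bound is [-oo] and the upper bound [+oo]. *)
have [Bfin|Boo] := boolP (Bx x \is a fin_num); last first.
  have -> : Bx x = +oo%E.
    by apply/eqP; move: Boo; rewrite ge0_fin_numE// ltey negbK.
  by rewrite /Ax/=; split; rewrite ?leNye ?leey.
(* Here [f x = 0], so the claim holds even if [J x] is infinite and [G x] is only a default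
   value. *)
have [a0|a0] := eqVneq (a x) 0.
  rewrite /f a0 mulr0 mul0r /Ax a0 normr0 powR0// mulr0.
  by rewrite sub0e add0e oppe_le0 abse0 B_ge0.
have pow0 : 0 < `|a x| `^ (p - 1) by rewrite powR_gt0// normr_gt0.
(* With a nonzero factor, finiteness of [Bx x] passes to [J x], and the integral defining [G x] can
   be split. *)
have Jfin : J x \is a fin_num.
  rewrite ge0_fin_numE// ltey; apply/negP => /eqP Joo.
  by move: Bfin; rewrite /Bx Joo mulry gtr0_sg// mul1e.
have ib : nu.-integrable setT (EFin \o (fun s => b (s, x))).
  apply/integrableP; split.
    apply/measurable_EFinP; exact: (measurable_fun_pair1 _ mb).
  by move: Jfin; rewrite ge0_fin_numE.
have GE : G x = K * a x - \int[nu]_s b (s, x).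
  rewrite /G RintegralB//; last exact: finite_measure_integrable_cst.
  by rewrite Rintegral_cst// mulrC.
have bJ : `|\int[nu]_s b (s, x)| <= fine (J x) by exact: le_normr_Rintegral.
have fb : `|f x * \int[nu]_s b (s, x)| <= fine (Bx x).
  rewrite normrM normf /Bx -(fineK Jfin) -EFinM/=.
  exact: ler_wpM2l.
rewrite -(fineK Bfin) /Ax -EFinB -EFinD !lee_fin GE mulrBr mulrCA fa.
split; first by rewrite lerD2l lerN2 (le_trans _ fb)// ler_norm.
rewrite (le_trans (ler_normB _ _))// lerD//.
by rewrite ger0_norm// mulr_ge0// powR_ge0.
Qed.

(** Integrating the lower bound of [bound] gives at least [K n^p - n^(p-1) M = n^(p-1) (n K - M)],
    which is the left-hand side. *)
Lemma delay_duality_inequality :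
  ((fine (N a) `^ (p - 1) *
    \int[nu]_s (fine (N a) - fine (N (fun x => b (s, x)))))%:E <=
  \int[mu]_x (`|a x| `^ (p - 2) * a x * g x)%:E)%E.
Proof.
have mfG : measurable_fun setT (fun x => (f x * G x)%:E).
  by apply/measurable_EFinP; exact: measurable_funM.
have fgG : ae_eq mu setT (fun x => (f x * G x)%:E) (fun x => (f x * g x)%:E).
  by apply: ae_imply gE => x -> _.
(* [g] is prescribed only almost everywhere; completeness of [mu] makes [f * g] measurable. *)
rewrite -(ae_eq_integral _ _ _ mfG _ fgG)//; last first.
  exact: (ae_measurable_fun cmu fgG mfG).
have ifG : mu.-integrable setT (fun x => (f x * G x)%:E).
  apply: (le_integrable measurableT mfG _ (integrableD measurableT iA iB)).
  by move=> x _; have [] := bound x.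
apply: (@le_trans _ _ (\int[mu]_x (Ax x - Bx x))%E); last first.
  apply: le_integral => //; first exact: integrableB.
  by move=> x _; have [] := bound x.
rewrite integralB// intA.
have iN : nu.-integrable setT (fun s => N (fun x => b (s, x))).
  apply/integrableP; split; first exact: measurable_Lnorm_param.
  rewrite (eq_integral (fun s => N (fun x => b (s, x))))//.
  by move=> s _; rewrite gee0_abs// Lnorm_ge0.
have -> : \int[nu]_s (fine (N a) - fine (N (fun x => b (s, x)))) = n * K - M.
  rewrite RintegralB//; last 2 first.
  - exact: finite_measure_integrable_cst.
  - exact: integrable_fine iN.
  rewrite Rintegral_cst//; congr (_ - _); congr fine.
  apply: ae_eq_integral => //.
  - by apply: (measurable_int nu); exact: integrable_fine iN.
  - exact: measurable_int iN.
  - by apply: ae_imply (integrable_ae measurableT iN) => s /(_ I) ? _; rewrite fineK.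
apply: (@le_trans _ _ ((K * n `^ p)%:E - (n `^ (p - 1))%:E * M%:E)%E); last first.
  by apply: leeB => //; rewrite -ME.
rewrite -EFinM -EFinB lee_fin -/n mulrBr lerD2r mulrCA mulrA.
have n0 : 0 <= n by apply: fine_ge0; exact: Lnorm_ge0.
suff -> : n `^ p = n `^ (p - 1) * n by rewrite mulrC [n * _]mulrC.
have [->|nn0] := eqVneq n 0; first by rewrite mulr0 powR0.
rewrite -[X in _ * X]powRr1// -powRD ?nn0 ?implybT//.
by congr (_ `^ _); rewrite subrK.
Qed.

End duality_inequality.

(** * The derivative inequality *)

Section history.
Context {R : realType}.
Local Notation mu := (@lebesgue_measure R).
Variable nu : {finite_measure set (measurableTypeR R) -> \bar R}.
Variables (T : R) (k k1 : R -> R).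
Hypothesis nuT : nu (~` `[0, T]) = 0%E.
Hypothesis k1k : {in `[0, T], k1 =1 k}.

(** For [psi] with constant history [c], subtracting [c] gives a function vanishing at negative
    times, as the primitive formula demands; the cut at [T] makes the constant integrable. *)
Definition truncate (psi : R -> R) (c : R) (s : R) : R :=
  if (0 <= s) && (s <= T) then psi s - c else 0.

Lemma truncate_lt0 psi c s : s < 0 -> truncate psi c s = 0.
Proof. by move=> s0; rewrite /truncate leNgt s0. Qed.

Lemma integrable_truncate psi c : mu.-integrable setT (EFin \o psi) ->
  mu.-integrable setT (EFin \o truncate psi c).
Proof.
move=> ipsi; pose b (s : R) := (0 <= s) && (s <= T).
have mb : measurable_fun setT b by apply: measurable_and; exact: measurable_fun_ler.
pose A : set R := `[0, T]%classic.
have -> : EFin \o truncate psi c =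
    ((fun s => (if b s then psi s else 0)%:E) \- (fun s => c%:E * (\1_A s)%:E))%E.
  apply/funext => s; rewrite /truncate /b/= /A indicE mem_setE in_itv/=.
  by case: ifP => _ /=; rewrite ?mulr1 ?mulr0 -?EFinB ?subr0.
apply: integrableB => //; first exact: integrable_if.
by apply: integrableZl => //; exact: integrable_indic_itv.
Qed.

(** The constant cancels in the difference. When [t - s < 0] the truncation is 0, which is
    [psi (t - s) - c] by the history; as [s <= T] and [t > 0], the history is only consulted on [[-
    T, 0[]. *)
Lemma delay_diff_truncate psi c t : measurable_fun setT psi ->
  (forall s, - T <= s -> s < 0 -> psi s = c) -> t \in `]0, T[ ->
  delay_diff nu (truncate psi c) t = \int[nu]_s (psi t - psi (t - s)).
Proof.
move=> mpsi psic tT; have t0T := tT; rewrite in_itv/= in t0T.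
have [t0 tltT] := andP t0T.
pose b (s : R) := (0 <= s) && (s <= T).
have mb : measurable_fun setT b by apply: measurable_and; exact: measurable_fun_ler.
have mtr : measurable_fun setT (truncate psi c).
  by apply: measurable_fun_ifT => //; exact: measurable_funB.
have msub : measurable_fun setT (fun s : R => t - s) by exact: measurable_funB.
congr fine; apply: ae_eq_integral => //.
- apply/measurable_EFinP; apply: measurable_funB => //.
  exact: (measurableT_comp mtr msub).
- apply/measurable_EFinP; apply: measurable_funB => //.
  exact: (measurableT_comp mpsi msub).
exists (~` `[0, T]); split => //; first exact: measurableC.
move=> s /= + sT; apply => _; congr EFin.
move: sT; rewrite in_itv/= => /andP[s0 sT].
rewrite {1}/truncate !ltW//= /truncate.
have [ts|ts] := leP 0 (t - s).
  by rewrite lerBlDr (le_trans (ltW tltT)) ?lerDl//=; ring.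
rewrite (psic (t - s))//= ?subr0//.
by rewrite lerBrDr (le_trans _ (ltW t0))// addrC subr_le0.
Qed.

(** Near an interior [t] the convolution sees its kernel and its argument only on [[0, T]], so both
    may be changed elsewhere. *)
Lemma derive1_time_conv_truncate psi c phi t :
  {in `[0, T], phi =1 (fun s => psi s - c)} -> t \in `]0, T[ ->
  derive1 (time_conv k phi) t = derive1 (time_conv k1 (truncate psi c)) t.
Proof.
move=> phiE tT; rewrite !derive1E; apply: near_eq_derive; near=> s.
have sT : s \in `]0, T[ by near: s; exact: near_in_itvoo.
have [s0 sltT] : 0 < s /\ s < T by move: sT; rewrite in_itv/= => /andP.
apply: eq_Rintegral => r; rewrite inE/= in_itv/= => /andP[r0 rs].
have rT : r <= T by rewrite (le_trans rs)// ltW.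
rewrite k1k; last first.
  by rewrite in_itv/= subr_ge0 rs lerBlDr (le_trans (ltW sltT))// lerDl.
by rewrite /truncate r0 rT phiE// in_itv/= r0.
Unshelve. all: by end_near. Qed.

End history.

(** * The inequality over a complete sigma-finite measure space *)

Section convolution_inequality.
Context d (X : measurableType d) {R : realType}.
Variable mX : {sigma_finite_measure set X -> \bar R}.
Hypothesis cmX : measure_is_complete mX.
Local Notation mu := (@lebesgue_measure R).
Variables (p T : R) (Omega : set X) (k : R -> R) (u0 : X -> R) (u : R -> X -> R).
Local Notation N f := ('N[mX]_p%:E[EFin \o f]%E).
Hypothesis p1 : 1 < p.
Hypothesis T0 : 0 < T.
Hypothesis mO : measurable Omega.
Hypothesis k0 : forall t, t \in `[0, T] -> 0 <= k t.
Hypothesis kni : {in `[0, T] &, forall s t, s <= t -> k t <= k s}.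
Hypothesis mu0 : measurable_fun setT (u0 \_ Omega).
Hypothesis Nu0 : (N (u0 \_ Omega) < +oo)%E.
Hypothesis mu_ : measurable_fun
  (`[0, T]%classic `*` Omega : set (measurableTypeR R * X))
  (fun z => u z.1 z.2).
Hypothesis Nu : (\int[mu]_(t in `[0%R, T]) N (u t \_ Omega) `^ p < +oo)%E.

Let p0 : 0 < p. Proof. exact: lt_trans p1. Qed.
Let pn0 : p != 0. Proof. by rewrite gt_eqF. Qed.

(* [u] extended by the constant history [u0] on [-T, 0[ *)
Let uh (z : R * X) : R :=
  ((fun z : R * X => u z.1 z.2) \_ (`[0, T]%classic `*` Omega)) z +
  (if (- T <= z.1) && (z.1 < 0) then (u0 \_ Omega) z.2 else 0).

Let muh : measurable_fun setT uh.
Proof.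
apply: measurable_funD.
  apply/(measurable_restrictT _ _).1; last exact: mu_.
  by apply: measurableX => //; exact: measurable_itv.
apply: measurable_fun_ifT => //.
  by apply: measurable_and;
    [exact: measurable_fun_ler|exact: measurable_fun_ltr].
exact: (measurableT_comp mu0).
Qed.

Let uh_pos s : s \in `[0, T] -> (fun x => uh (s, x)) = u s \_ Omega.
Proof.
rewrite in_itv/= => /andP[s0 sT]; apply/funext => x.
rewrite /uh/= !patchE ltNge s0 andbF addr0.
by rewrite in_setX/= mem_setE in_itv/= s0 sT.
Qed.

Let uh_neg s : - T <= s -> s < 0 -> (fun x => uh (s, x)) = u0 \_ Omega.
Proof.
move=> Ts s0; apply/funext => x.
by rewrite /uh/= patchE in_setX/= mem_setE in_itv/= leNgt s0 Ts add0r.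
Qed.

Let uh_out s : (s < - T) || (T < s) -> (fun x => uh (s, x)) = cst 0.
Proof.
move=> sT; apply/funext => x.
rewrite /uh/= patchE in_setX/= mem_setE in_itv/=.
case/orP: sT => sT.
  rewrite [0 <= s]leNgt (lt_trans sT) ?oppr_lt0//= leNgt sT/= addr0//.
rewrite [s <= T]leNgt sT andbF/=.
by rewrite [s < 0]ltNge (ltW (lt_trans T0 sT)) andbF addr0.
Qed.

Let Nh s := N (fun x => uh (s, x)).

Let mNh : measurable_fun setT Nh.
Proof. exact: (measurable_Lnorm_param _ _ (measurableTypeR R) X mX p uh muh). Qed.

Let Nh_ge0 s : (0 <= Nh s)%E. Proof. exact: Lnorm_ge0. Qed.

Let I : R -> R := \1_(`[- T, T]%classic : set R).

Let mI : measurable_fun setT I.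
Proof. exact: measurable_indic. Qed.

Let intI : (\int[mu]_s (I s)%:E < +oo)%E.
Proof.
rewrite integral_indic// setIT [X in (X < _)%E]lebesgue_measure_itv/=.
by case: ifP => // _; rewrite -EFinB ltry.
Qed.

(** Turns [p]-integrability into integrability for functions supported in [[- T, T]], with the
    indicator [I] in place of 1. *)
Let le_add1_powR (y : R) : 0 <= y -> y <= 1 + y `^ p.
Proof.
move=> y0; have [y1|y1] := leP y 1.
  by rewrite (le_trans y1)// lerDl powR_ge0.
rewrite -[leLHS]powRr1// (@le_trans _ _ (y `^ p)) ?lerDr//.
by apply: ler_powR; exact: ltW.
Qed.

Let Nhp s := (Nh s `^ p)%E.

Let mNhp : measurable_fun setT Nhp.
Proof. exact: (measurableT_comp (measurable_poweR _)). Qed.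

(** On [[0, T]] this is the hypothesis [Nu]; the history adds at most the constant [c] on a bounded
    interval. *)
Let intNhp : (\int[mu]_s Nhp s < +oo)%E.
Proof.
pose c := (N (u0 \_ Omega) `^ p)%E.
have c0 : (0 <= c)%E by exact: poweR_ge0.
have cfin : c \is a fin_num.
  by rewrite ge0_fin_numE//; apply: poweR_lty.
have mN0T : measurable_fun setT (Nhp \_ `[0, T]).
  by apply/(measurable_restrictT _ _).1 => //; exact: measurable_funTS.
apply: (@le_lt_trans _ _ (\int[mu]_s ((Nhp \_ `[0%R, T]) s + c * (I s)%:E))%E).
  apply: ge0_le_integral => //.
  - by move=> s _; exact: poweR_ge0.
  - apply: emeasurable_funD => //; apply: emeasurable_funM => //.
    exact/measurable_EFinP.
  - move=> s _; rewrite patchE mem_setE in_itv/= /I indicE mem_setE in_itv/=.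
    have [sT|] := boolP ((s < - T) || (T < s)).
      rewrite /Nhp /Nh uh_out// (_ : EFin \o _ = cst 0%E)// Lnorm0 ?eqe//.
      rewrite poweR0r//; case: ifP => _.
        by rewrite adde_ge0// ?poweR_ge0// mule_ge0// lee_fin.
      by rewrite add0e mule_ge0// lee_fin.
    rewrite negb_or -!leNgt => /andP[Ts sT]; rewrite Ts sT/= mule1 andbT.
    have [s0|s0] := leP 0 s; first by rewrite leeDl.
    by rewrite add0e /Nhp /Nh uh_neg.
rewrite ge0_integralD//; last 3 first.
- by move=> s _; rewrite patchE; case: ifP => // _; exact: poweR_ge0.
- by move=> s _; rewrite mule_ge0// lee_fin.
- by apply: emeasurable_funM => //; exact/measurable_EFinP.
rewrite lte_add_pinfty//.
  rewrite -integral_mkcond; apply: le_lt_trans Nu.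
  rewrite le_eqVlt; apply/orP; left; apply/eqP; apply: eq_integral => s.
  by rewrite inE/= => sT; rewrite /Nhp /Nh uh_pos.
rewrite ge0_integralZl//.
- by rewrite lte_mul_pinfty.
- exact/measurable_EFinP.
- by move=> s _; rewrite lee_fin.
Qed.

Let intNh : (\int[mu]_s Nh s < +oo)%E.
Proof.
apply: (@le_lt_trans _ _ (\int[mu]_s ((I s)%:E + Nhp s))%E).
  apply: ge0_le_integral => //.
  - by apply: emeasurable_funD => //; exact/measurable_EFinP.
  - move=> s _; rewrite /I indicE mem_setE in_itv/=.
    have [sT|] := boolP ((s < - T) || (T < s)).
      rewrite [in leLHS]/Nh uh_out// (_ : EFin \o _ = cst 0%E)// Lnorm0 ?eqe//.
      by rewrite adde_ge0 ?lee_fin ?poweR_ge0.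
    rewrite negb_or -!leNgt => /andP[-> ->]/=; rewrite /Nhp.
    have := Nh_ge0 s; case: (Nh s) => [r|_|//]; rewrite ?lee_fin.
      by move=> r0; rewrite ?poweR_EFin -?EFinD ?lee_fin le_add1_powR.
    by rewrite poweRyr// addey.
rewrite ge0_integralD//; last 3 first.
- by move=> s _; rewrite lee_fin.
- exact/measurable_EFinP.
- by move=> s _; exact: poweR_ge0.
by rewrite lte_add_pinfty.
Qed.

Let iNh : mu.-integrable setT Nh.
Proof.
apply/integrableP; split => //.
by under eq_integral do rewrite gee0_abs//.
Qed.

(** By Tonelli the double integral of [|uh| ^ p] is that of [Nhp], so almost every section is
    [p]-integrable in time, and [le_add1_powR] applies on its bounded support. *)
Let ae_integrable_uh :
  {ae mX, forall x, mu.-integrable setT (fun s => (uh (s, x))%:E)}.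
Proof.
pose h (z : R * X) : \bar R := (`|uh z| `^ p)%:E.
have mh : measurable_fun setT h.
  apply/measurable_EFinP; apply: (measurableT_comp (measurable_powR _)).
  exact: measurableT_comp.
have h0 z : (0 <= h z)%E by rewrite lee_fin powR_ge0.
have hx : mX.-integrable setT (fun x => \int[mu]_s h (s, x))%E.
  apply/integrableP; split; first exact: (@measurable_fun_fubini_tonelli_G _ _
    (measurableTypeR R) X R mu h mh h0).
  under eq_integral do rewrite gee0_abs ?integral_ge0//.
  rewrite -(@fubini_tonelli _ _ (measurableTypeR R) X R mu mX h mh h0).
  apply: le_lt_trans intNhp.
  rewrite le_eqVlt; apply/orP; left; apply/eqP; apply: eq_integral => s _.
  by rewrite /Nhp /Nh poweR_Lnorm.
apply: ae_imply (integrable_ae measurableT hx) => x /(_ Logic.I) hfin.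
have mux : measurable_fun setT (fun s => uh (s, x)).
  exact: (measurable_fun_pair1 _ muh).
apply/integrableP; split; first exact/measurable_EFinP.
apply: (@le_lt_trans _ _ (\int[mu]_s ((I s)%:E + h (s, x)))%E).
  apply: ge0_le_integral => //.
  - by apply: measurableT_comp => //; exact/measurable_EFinP.
  - apply: emeasurable_funD; first exact/measurable_EFinP.
    exact: (measurable_fun_pair1 _ mh).
  - move=> s _; rewrite /I indicE mem_setE in_itv/= /h.
    have [sT|] := boolP ((s < - T) || (T < s)).
      have -> : uh (s, x) = 0 by have := congr1 (@^~ x) (uh_out s sT).
      by rewrite normr0 adde_ge0 ?lee_fin ?powR_ge0.
    rewrite negb_or -!leNgt => /andP[-> ->]/=.
    by rewrite lee_fin le_add1_powR.
rewrite ge0_integralD//; last 3 first.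
- by move=> s _; rewrite lee_fin.
- exact/measurable_EFinP.
- exact: (measurable_fun_pair1 _ mh).
rewrite lte_add_pinfty//.
by move: hfin; rewrite ge0_fin_numE// integral_ge0.
Qed.

(** By Tonelli and translation invariance, the integral over [t] is [nu setT] times the finite
    integral of [Nh]. *)
Let ae_int_Nh (nu : {finite_measure set (measurableTypeR R) -> \bar R}) :
  {ae mu, forall t, (\int[nu]_s Nh (t - s)%R < +oo)%E}.
Proof.
pose h (z : R * R) := Nh (z.1 - z.2).
have mh : measurable_fun setT h.
  by apply: (measurableT_comp mNh); exact: measurable_funB.
have hx : mu.-integrable setT (fun t => \int[nu]_s h (t, s))%E.
  apply/integrableP; split.
    exact: (@measurable_fun_fubini_tonelli_F _ _ (measurableTypeR R)
      (measurableTypeR R) R nu h mh (fun z => Nh_ge0 _)).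
  have -> : (\int[mu]_t `|\int[nu]_s h (t, s)| =
      \int[mu]_t \int[nu]_s h (t, s))%E.
    apply: eq_integral => t _; rewrite gee0_abs//.
    by apply: integral_ge0 => s _; exact: Nh_ge0.
  rewrite (@fubini_tonelli _ _ (measurableTypeR R) (measurableTypeR R) R mu nu
    h mh (fun z => Nh_ge0 _)).
  have -> : (\int[nu]_s \int[mu]_t h (t, s) =
      \int[nu]_s cst (\int[mu]_x Nh x) s)%E.
    by apply: eq_integral => s _; exact: ge0_integral_shift.
  rewrite integral_cst// lte_mul_pinfty//; first exact: integral_ge0.
    by rewrite ge0_fin_numE// integral_ge0.
  by rewrite ltey_eq fin_num_measure.
apply: ae_imply (integrable_ae measurableT hx) => t /(_ Logic.I).
by rewrite ge0_fin_numE//; apply: integral_ge0 => s _; exact: Nh_ge0.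
Qed.

Lemma convolution_derivative_inequality :
  {ae mu, forall t, t \in `]0, T[ ->
    ((fine (N (u t \_ Omega)) `^ (p - 1) *
      derive1 (time_conv k
        (fun s => fine (N (u s \_ Omega)) - fine (N (u0 \_ Omega)))) t)%:E
    <= \int[mX]_(x in Omega)
        (`|u t x| `^ (p - 2) * u t x *
         derive1 (time_conv k (fun s => u s x - u0 x)) t)%:E)%E}.
Proof.
have [nu [nuT nuk]] := nonincreasing_kernel_measure T k T0 k0 kni.
have [k1 [mk1 k1k]] := nonincreasing_measurable_extension T k T0 kni.
have nuk1 : {ae mu, forall r, r \in `[0, T] -> nu `]r, +oo[%classic = (k1 r)%:E}.
  by apply: ae_imply nuk => r H rT; rewrite H// k1k.
pose n0 := fine (N (u0 \_ Omega)).
pose w (z : R * X) :=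
  truncate T (fun s => uh (s, z.2)) ((u0 \_ Omega) z.2) z.1.
have mw : measurable_fun setT w.
  apply: measurable_fun_ifT => //.
    by apply: measurable_and; exact: measurable_fun_ler.
  apply: measurable_funB; last exact: (measurableT_comp mu0).
  by rewrite (_ : (fun _ => _) = uh)//; apply/funext => -[].
have iw : {ae mX, forall x, mu.-integrable setT (fun s => (w (s, x))%:E)}.
  apply: ae_imply ae_integrable_uh => x ux.
  exact: (integrable_truncate T (fun s => uh (s, x)) ((u0 \_ Omega) x) ux).
have dw := ae_time_conv_derive _ _ mX nu T k1 w mk1 nuT nuk1 mw
  (fun s x => truncate_lt0 T _ _ s) iw.
have ifNh := integrable_fine _ _ _ _ iNh.
have mfNh : measurable_fun setT (fun s => fine (Nh s)).
  exact: measurableT_comp.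
pose v := truncate T (fun s => fine (Nh s)) n0.
have dv := time_conv_derive nu T k1 v mk1 nuT nuk1
  (integrable_truncate T _ n0 ifNh) (truncate_lt0 T _ _).
(* [Q t] collects the finiteness hypotheses of [delay_duality_inequality] at time [t]. *)
pose Q t := (\int[nu]_s Nh (t - s)%R < +oo)%E /\ Nh t \is a fin_num.
have aeQ : {ae mu, forall t, Q t}.
  apply: ae_imply2 (ae_int_Nh nu) (integrable_ae measurableT iNh) => t Nht.
  by move=> /(_ Logic.I).
have aeQv : {ae mu, forall t, Q t /\ (t \in `]0, T[ ->
    derive1 (time_conv k1 v) t = delay_diff nu v t)}.
  by apply: ae_imply2 aeQ dv => t Qt vt; split => // tT; have [] := vt tT.
apply: ae_imply2 aeQv dw => t [[intNht Nht] dvt] dwt tT.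
have tT' : t \in `[0, T] by exact: subset_itv_oo_cc.
have NhE s : s \in `[0, T] -> N (u s \_ Omega) = Nh s.
  by move=> sT; rewrite /Nh uh_pos.
rewrite NhE//.
rewrite (derive1_time_conv_truncate T k k1 k1k (fun s => fine (Nh s)) n0)//; last first.
  by move=> s sT; rewrite NhE.
rewrite dvt//.
(* The norm of the extended function has the constant history [n0]. *)
rewrite (delay_diff_truncate nu T nuT)//; last first.
  by move=> s Ts s0; rewrite /Nh uh_neg.
have muht : measurable_fun setT (fun x => uh (t, x)).
  exact: (measurable_fun_pair2 _ muh).
pose b (z : measurableTypeR R * X) := uh (t - z.1, z.2).
have mb : measurable_fun setT b.
  have mg : measurable_fun setT (fun z : measurableTypeR R * X => (t - z.1, z.2)).
    apply: measurable_fun_pair => //.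
    exact: (measurable_funB (f := cst t) (g := fst)).
  exact: (measurableT_comp muh mg).
have gE : {ae mX, forall x, derive1 (time_conv k1 (fun s => w (s, x))) t =
    \int[nu]_s (uh (t, x) - b (s, x))}.
  apply: ae_imply (dwt tT) => x ->.
  apply: (delay_diff_truncate nu T nuT (fun s => uh (s, x))
    ((u0 \_ Omega) x)) => //.
    exact: (measurable_fun_pair1 _ muh).
  by move=> s Ts s0; exact: (congr1 (@^~ x) (uh_neg s Ts s0)).
have Nht' : (N (fun x => uh (t, x)) < +oo)%E.
  by rewrite -ge0_fin_numE// Lnorm_ge0.
apply: le_trans (delay_duality_inequality _ _ (measurableTypeR R) X mX nu p cmX p1
  _ _ b muht mb Nht' intNht gE) _.
(* Off [Omega] the factor [uh (t, x)] is 0; on [Omega] the derivatives agree by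
   [derive1_time_conv_truncate]. *)
rewrite [leRHS]integral_mkcond le_eqVlt; apply/orP; left; apply/eqP.
apply: eq_integral => x _.
have := congr1 (@^~ x) (uh_pos t tT'); rewrite /= !patchE => ->.
case: ifPn => [xO|_]; last by rewrite mulr0 mul0r.
rewrite (derive1_time_conv_truncate T k k1 k1k
  (fun s => uh (s, x)) ((u0 \_ Omega) x))//.
move=> s sT; have := congr1 (@^~ x) (uh_pos s sT).
by rewrite /= !patchE xO => ->.
Qed.

End convolution_inequality.

Theorem corollary3p1 (R : realType) (N : nat) (p T : R)
    (Omega : set (euclidean R N)) (k : R -> R)
    (u0 : euclidean R N -> R) (u : R -> euclidean R N -> R) :
  1 < p -> 0 < T -> measurable Omega ->
  W11 T k ->
  (forall t, t \in `[0, T] -> 0 <= k t) ->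
  {in `[0, T] &, forall s t, s <= t -> k t <= k s} ->
  in_Lp Omega p u0 ->
  in_LpLp Omega p T u ->
  {ae @lebesgue_measure R, forall t, t \in `]0, T[ ->
    ((Lp_norm Omega p (u t) `^ (p - 1) *
      derive1 (time_conv k
         (fun s => Lp_norm Omega p (u s) - Lp_norm Omega p u0)) t)%:E
    <= \int[@lebesgueN R N]_(x in Omega)
        (`|u t x| `^ (p - 2) * u t x *
         derive1 (time_conv k (fun s => u s x - u0 x)) t)%:E)%E}.
Proof.
move=> p1 T0 mO _ k0 kni.
move=> u0p [mu_ Nu].
have := sub_Lfun_mfun u0p; rewrite inE/= => mu0.
have := sub_Lfun_finLfun u0p; rewrite inE/= => Nu0.
apply: (convolution_derivative_inequality _ _ (@lebesgueN R N)) => //.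
(* Completeness comes from using the Caratheodory sigma-algebra on [R^N] rather than the Borel
   one. *)
exact: measure_is_complete_caratheodory.
Qed.
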